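(* Let $r>0$, $0<p<1$. For any non-negative integer $n$, $$G_2^{[0,n]}\le\frac{1-\pi_0}{pr}=\frac{\mathbb{P}(1\le Z\le n)}{pr\,\mathbb{P}(Z\le n)},$$ where $Z\sim\mathrm{NB}(r,p)$ and $\pi_0=\mathbb{P}(Z^{[0,n]}=0)=\mathbb{P}(Z=0)/\mathbb{P}(Z\le n)$. Furthermore, this bound is sharp (i.e. it is attained: equality holds) and the bound is increasing in $n$.
   Context: The negative binomial distribution $\mathrm{NB}(r,p)$ ($r>0$, $0<p<1$) has mass function $P(Z=k)=\frac{\Gamma(r+k)}{\Gamma(r)k!}(1-p)^rp^k$, $k\in\{0,1,2,\ldots\}$. For a non-negative integer $n$, $Z^{[0,n]}$ denotes a random variable with the law of $Z$ conditioned on $Z\le n$, and $\mathrm{NB}^{[0,n]}(r,p)$ is the law of $Z^{[0,n]}$ when $Z\sim\mathrm{NB}(r,p)$. For $A\subset\{0,\ldots,n\}$ and $f=\mathbf{1}_A$, let $g_f:\{0,1,\ldots,n+1\}\to\mathbb{R}$ be the solution of the Stein equation $$p(r+i)g_f(i+1)\mathbf{1}_{i<n}-i\,g_f(i)=f(i)-\mathbb{E}f(Z^{[0,n]}),\quad i\in\{0,\ldots,n\},$$ with $Z^{[0,n]}\sim\mathrm{NB}^{[0,n]}(r,p)$, normalized by $g_f(0)=0$ and $g_f(n+1)=0$ (these two values are not determined by the equation). Then $$G_2^{[0,n]}:=\sup_{f}\ \sup_{i\in\{0,\ldots,n\}}|g_f(i+1)-g_f(i)|,$$ the first supremum being over all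 $f=\mathbf{1}_A$ with $A\subset\{0,\ldots,n\}$. *)

(* Defs.v *)
From mathcomp Require Import all_boot all_order all_algebra.
From mathcomp Require Import all_classical all_reals all_analysis.

Set Implicit Arguments.
Unset Strict Implicit.
Unset Printing Implicit Defensive.

Import Order.TTheory GRing.Theory Num.Theory.
Import numFieldNormedType.Exports.

Local Open Scope classical_set_scope.
Local Open Scope ring_scope.

(* Euler's integral; as a Lebesgue integral it is only meaningful for s > 0. *)
Definition Gamma (R : realType) (s : R) : R :=
  \int[lebesgue_measure]_(t in `]0, +oo[) (t `^ (s - 1) * expR (- t)).

Definition nb_pmf (R : realType) (r p : R) (k : nat) : R :=
  Gamma (r + k%:R) / (Gamma r * k`!%:R) * (1 - p) `^ r * p ^+ k.

Definition is_NB (R : realType) (r p : R) (d : measure_display)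
    (T : measurableType d) (P : probability T R) (Z : {RV P >-> nat}) : Prop :=
  forall k : nat, P [set t | Z t = k] = (nb_pmf r p k)%:E.

Lemma measurable_leqn (n : nat) : measurable [set k : nat | (k <= n)%N].
Proof. by []. Qed.

(* The law of Z conditioned on Z <= n, as a probability measure on nat. The
   second argument of mnormalize is a default value, used by the library only
   when P (Z <= n) = 0. *)
Definition truncated_law (R : realType) (d : measure_display)
    (T : measurableType d) (P : probability T R) (Z : {RV P >-> nat})
    (n : nat) : probability nat R :=
  mnormalize (mrestr (distribution P Z) (measurable_leqn n)) \d_0%N.

(* g is the solution g_f of the Stein equation for the law mu on {0, ..., n};
   only the values of g on {0, ..., n + 1} are relevant. *)
Definition is_stein_solution (R : realType) (r p : R) (mu : probability nat R)
    (n : nat) (f g : nat -> R) : Prop :=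
  [/\ g 0%N = 0, g n.+1 = 0 &
      forall i : nat, (i <= n)%N ->
        p * (r + i%:R) * g i.+1 * (i < n)%N%:R - i%:R * g i
        = f i - fine 'E_mu[f] ].

(* The suprema are taken in \bar R: by definition of ereal_sup, an empty
   supremum is -oo and an unbounded one is +oo. *)
Definition G2 (R : realType) (r p : R) (mu : probability nat R) (n : nat)
    : \bar R :=
  ereal_sup
    [set ereal_sup [set `|g i.+1 - g i|%:E | i in [set i | (i <= n)%N]]
    | g in [set g : nat -> R | exists2 A : set nat, A `<=` [set k | (k <= n)%N]
              & is_stein_solution r p mu n \1_A g]].

Definition pi0 (R : realType) (d : measure_display) (T : measurableType d)
    (P : probability T R) (Z : {RV P >-> nat}) (n : nat) : R :=
  fine (truncated_law Z n [set 0%N]).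

Definition G2_bound (R : realType) (r p : R) (d : measure_display)
    (T : measurableType d) (P : probability T R) (Z : {RV P >-> nat})
    (n : nat) : R :=
  (1 - pi0 Z n) / (p * r).

(* Main.v *)
Require Import Defs.
From mathcomp Require Import all_boot all_order all_algebra.
From mathcomp Require Import all_classical all_reals all_analysis.
From mathcomp Require Import measurable_realfun ring lra.

Set Implicit Arguments.
Unset Strict Implicit.
Unset Printing Implicit Defensive.

Import Order.TTheory GRing.Theory Num.Theory.
Import numFieldNormedType.Exports.
Local Open Scope classical_set_scope.
Local Open Scope ring_scope.

(** Write w for the mass function of NB(r,p) conditioned on {0, ..., n}, and
    F i, U i for its mass strictly below and strictly above i. The functional
    equation of Gamma turns the mass function into the detailed-balance relation
    (k+1) w(k+1) = p (r+k) w(k), which is exactly what makes the Stein equation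
    telescope once it is multiplied by w(i): its solution is given by the partial
    sums of w (f - E f). Substituting this in g(i+1) - g(i) gives, for i > 0,
<<
      w(i) (g(i+1) - g(i)) = c w(i) f(i) - a A - b B,
>>
    where A and B are the integrals of f strictly below and strictly above i and
    a, b, c depend on i only. The coefficients a and b are nonnegative: these are
    the two tail-ratio inequalities [upper_tail_ratio] and [lower_tail_ratio].
    Since f = 1 has g = 0, we have c w(i) = a F(i) + b U(i); so for 0 <= f <= 1
    the increment lies between -c and c.

    It remains to bound c = U(i) / (p (r+i)) + F(i) / i. The denominator of the
    first term is at least p r, and shifting the sum F(i) by one index with the
    detailed-balance relation gives F(i) / i <= (w(1) + ... + w(i)) / (p r). Hence
    c <= (1 - w(0)) / (p r) ([diagonal_coef_le]). At i = 0 the increment is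
    (U(0) f(0) - B) / (p r), which obeys the same bound and attains it for the
    indicator of {0}. Finally 1 - w(0) is 1 minus the ratio of P(Z = 0) to
    P(Z <= n), which increases strictly in n because every point of the natural
    numbers has positive mass. *)

(** * The functional equation of the Gamma function *)

Lemma is_derive_powR_expRN (R : realType) (s x : R) : 0 < x ->
  is_derive x 1 (fun t => t `^ s * expR (- t))
    (s * (x `^ (s - 1) * expR (- x)) - x `^ s * expR (- x)).
Proof.
move=> x0; have hs := is_derive1_powR s x0.
have he : is_derive x 1 (fun t : R => expR (- t)) (- expR (- x)).
  by apply: is_derive_eq; rewrite /GRing.scale/= ?mulN1r ?mulrN1.
apply: (is_derive_eq (is_deriveM hs he)).
by rewrite /GRing.scale/=; ring.
Qed.

Lemma continuous_powR_expRN (R : realType) (s x : R) : 0 < x ->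
  {for x, continuous (fun t => t `^ s * expR (- t))}.
Proof.
move=> x0; apply: differentiable_continuous; apply/derivable1_diffP.
by have [] := is_derive_powR_expRN s x0.
Qed.

(** From x <= 2 s exp(x / (2 s)) one gets x^s <= (2 s)^s exp(x / 2), which half of
    the exponential decay absorbs. *)
Lemma cvgy_powR_expRN (R : realType) (s : R) : 0 < s ->
  x `^ s * expR (- x) @[x --> +oo] --> 0.
Proof.
move=> s0; pose c := (2 * s) `^ s.
apply: (@squeeze_cvgr _ _ _ _ (cst 0) (fun x : R => c * expR (- (2^-1 * x)))).
- near=> x; have x0 : 0 <= x by near: x; apply: nbhs_pinfty_ge; rewrite num_real.
  rewrite mulr_ge0 ?powR_ge0 ?expR_ge0//=.
  rewrite [X in expR (- X)](_ : x = 2^-1 * x + 2^-1 * x); last by field.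
  rewrite opprD expRD mulrA ler_wpM2r ?expR_ge0// -[leRHS]mulr1.
  rewrite -[X in _ <= _ * X](expRxMexpNx_1 (2^-1 * x)) mulrA.
  rewrite ler_wpM2r ?expR_ge0//.
  have -> : expR (2^-1 * x) = expR ((2 * s)^-1 * x) `^ s.
    by rewrite -expRM; congr expR; field; rewrite gt_eqF.
  rewrite -powRM ?expR_ge0 ?mulr_ge0 ?(ltW s0)//.
  rewrite ge0_ler_powR ?nnegrE ?(ltW s0)// ?mulr_ge0 ?expR_ge0 ?(ltW s0)//.
  have := expR_ge1Dx ((2 * s)^-1 * x).
  rewrite -(ler_pM2l (mulr_gt0 (ltr0Sn R 1) s0)) mulrDr mulVKf; last first.
    by rewrite mulf_neq0 ?gt_eqF.
  by apply: le_trans; rewrite lerDr mulr1 mulr_ge0 ?(ltW s0).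
- exact: cvg_cst.
- rewrite -[X in _ --> X](mulr0 c); apply: cvgM; first exact: cvg_cst.
  apply: (@cvg_comp _ _ _ (fun x => 2^-1 * x) (fun z => expR (- z)) _
    (pinfty_nbhs R)); last exact: cvgr_expR.
  exact: gt0_cvgMry.
Unshelve. all: by end_near. Qed.

(** Integrating the derivative of t^s exp(-t) over [1/(n+2), n+2] relates the two
    truncated Gamma integrals up to a boundary term that vanishes as n grows. The
    limit is taken in the extended reals, where monotone convergence needs no
    integrability; passing to [fine] is harmless because the two integrals are
    finite or infinite together. *)
Lemma Gamma_add1 (R : realType) (s : R) : 0 < s ->
  Gamma (s + 1) = s * Gamma s.
Proof.
move=> s0; rewrite /Gamma addrK /Rintegral.
pose f (u t : R) := t `^ u * expR (- t).
pose J (n : nat) : set R := `[n.+2%:R^-1, n.+2%:R]%classic.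
pose I u n := (\int[lebesgue_measure]_(t in J n) (f u t)%:E)%E.
have J0 n x : J n x -> 0 < x.
  by rewrite /J/= in_itv/= => /andP[+ _]; apply: lt_le_trans; rewrite invr_gt0.
have ab n : n.+2%:R^-1 < n.+2%:R :> R.
  by rewrite (@lt_trans _ _ 1)// ?invf_lt1 ?ltr1n.
have mJ n : measurable (J n) by exact: measurable_itv.
have ndJ : nondecreasing_seq J.
  move=> m n mn; rewrite subsetEset => x; rewrite /J/= !in_itv/= => /andP[h1 h2].
  apply/andP; split; last by rewrite (le_trans h2)// ler_nat !ltnS.
  by rewrite (le_trans _ h1)// lef_pV2 ?posrE// ler_nat !ltnS.
have UJ : \bigcup_n J n = `]0, +oo[%classic.
  apply/seteqP; split=> [x [n _ /J0]|x]; first by rewrite /= in_itv/= andbT.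
  rewrite /= in_itv/= andbT => x0.
  exists (maxn (Num.truncn x) (Num.truncn x^-1)) => //.
  rewrite /J/= in_itv/=; apply/andP; split.
    rewrite invf_ple ?posrE//; apply: ltW.
    apply: (lt_le_trans (truncnS_gt _)).
    by rewrite ler_nat ltnS leqW// leq_maxr.
  apply: ltW; apply: (lt_le_trans (truncnS_gt _)).
  by rewrite ler_nat ltnS leqW// leq_maxl.
have cf u n : {within J n, continuous (f u)}.
  apply: continuous_in_subspaceT => x; rewrite inE => /J0.
  exact: continuous_powR_expRN.
have f0 u x : 0 <= f u x by rewrite mulr_ge0 ?powR_ge0 ?expR_ge0.
have Icvg u :
    I u n @[n --> \oo] --> (\int[lebesgue_measure]_(t in `]0%R, +oo[) (f u t)%:E)%E.
  rewrite -UJ; apply: ge0_nondecreasing_set_cvg_integral => //.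
    move=> n; apply/measurable_EFinP.
    by apply: subspace_continuous_measurable_fun; [exact: mJ|exact: cf].
  by move=> n x _; rewrite lee_fin.
have Iint u n : lebesgue_measure.-integrable (J n) (EFin \o f u).
  by apply: continuous_compact_integrable; [exact: segment_compact|exact: cf].
have Ifin u n : I u n \is a fin_num by apply: integrable_fin_num; [exact: mJ|exact: Iint].
have Irec n : (s%:E * I (s - 1)%R n = I s n + (f s n.+2%:R - f s n.+2%:R^-1)%:E)%E.
  have := @continuous_FTC2 _ (fun t => s * f (s - 1) t - f s t) (f s)
     n.+2%:R^-1 n.+2%:R (ab n).
  have cphi x : 0 < x -> {for x, continuous (f s)}.
    exact: continuous_powR_expRN.
  rewrite -EFinB => <- //.
  - rewrite [X in (_ + X)%E](_ : _ = s%:E * I (s - 1)%R n - I s n)%E.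
      by rewrite addeC subeK.
    rewrite -integralZl; [|exact: mJ|exact: Iint].
    rewrite -integralB; [|exact: mJ| |exact: Iint].
      by apply: eq_integral => x _; rewrite EFinB EFinM.
    by apply: integrableZl; [exact: mJ|exact: Iint].
  - move=> x; apply: cvgB; last exact: cf.
    by apply: cvgM; [exact: cvg_cst|exact: cf].
  - split.
    + move=> x xJ; have /J0 x0 : J n x by apply: subset_itv_oo_cc.
      by have [] := is_derive_powR_expRN s x0.
    + by apply/cvg_at_right_filter/cphi; rewrite invr_gt0.
    + by apply/cvg_at_left_filter/cphi.
  - move=> x xJ; have /J0 x0 : J n x by apply: subset_itv_oo_cc.
    by rewrite derive1E; have [_ ->] := is_derive_powR_expRN s x0.
have bdry : (f s n.+2%:R - f s n.+2%:R^-1)%:E @[n --> \oo] --> 0%E.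
  apply: cvg_EFin; first by near=> n.
  rewrite -[X in _ --> X](subr0 0).
  have natoo : (n.+2%:R : R) @[n --> \oo] --> +oo.
    apply/cvgryPge => A; near=> n; apply: ltW; rewrite (lt_trans (truncnS_gt A))//.
    by rewrite ltr_nat !ltnS; near: n; exists (Num.truncn A).
  apply: cvgB.
    apply: (@cvg_comp _ _ _ (fun n : nat => n.+2%:R) (f s) _ (pinfty_nbhs R) _ natoo).
    exact: cvgy_powR_expRN.
  have : f s x @[x --> 0^'+] --> 0 * expR (- 0).
    apply: cvgM; first exact: powR_cvg0.
    apply: cvg_at_right_filter.
    by apply: (@cvg_comp _ _ _ -%R expR); [exact: opp_continuous|exact: continuous_expR].
  rewrite mul0r => h.
  apply: (cvg_at_rightP _ _ _).1 h _ _; split.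
    by move=> n; rewrite invr_gt0.
  by apply/gtr0_cvgV0 => //; near=> n.
pose G u := (\int[lebesgue_measure]_(t in `]0%R, +oo[) (f u t)%:E)%E.
have G_rec : G s = (s%:E * G (s - 1)%R)%E.
  have h1 : (s%:E * I (s - 1)%R n)%E @[n --> \oo] --> G s.
    rewrite (funext Irec).
    rewrite -[X in _ --> X]adde0.
    by apply: (cvgeD _ (Icvg s) bdry); rewrite fin_num_adde_defl.
  have h2 : (s%:E * I (s - 1)%R n)%E @[n --> \oo] --> (s%:E * G (s - 1)%R)%E.
    by exact: (cvgeZl _ (Icvg (s - 1))).
  exact: cvg_unique h1 h2.
rewrite -/(f s) -/(f (s - 1)) -/(G s) -/(G (s - 1)) G_rec; case: (G (s - 1)) => [x| |].
- by [].
- by rewrite gt0_muley ?lte_fin//= mulr0.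
- by rewrite gt0_muleNy ?lte_fin//= mulr0.
Unshelve. all: by end_near. Qed.

(** * Tail inequalities for the weights *)

Section Weights.
Context (R : realType) (r p : R) (w : nat -> R).
Hypotheses (r_gt0 : 0 < r) (p_gt0 : 0 < p) (p_lt1 : p < 1).
Hypothesis w_gt0 : forall k, 0 < w k.
Hypothesis w_rec : forall k, k.+1%:R * w k.+1 = p * (r + k%:R) * w k.

Lemma sum_weight_ge0 m n : 0 <= \sum_(m <= k < n) w k.
Proof. by apply: sumr_ge0 => k _; exact: ltW. Qed.

Lemma rate_gt0 i : 0 < p * (r + i%:R).
Proof. by rewrite mulr_gt0// ltr_pwDl. Qed.

(** The difference of the two sides grows by (1 - p) F(i+1) from i to i+1. *)
Lemma lower_tail_ratio i :
  p * (r + i%:R) * \sum_(0 <= k < i) w k <= i%:R * \sum_(0 <= k < i.+1) w k.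
Proof.
elim: i => [|i IH]; first by rewrite big_geq// mulr0 mul0r.
have := sum_weight_ge0 0 i; have := w_rec i; have := w_gt0 i.
move: IH; rewrite !big_nat_recr//= -!natr1.
set F := \sum_(0 <= k < i) w k => IH wi rec F0.
have : 0 <= (1 - p) * (F + w i).
  by rewrite mulr_ge0 ?subr_ge0 ?addr_ge0// ltW.
lra.
Qed.

(** The difference of the two sides grows by (1 - p) U(i) from i+1 to i, hence an
    induction that starts at i = n and goes down. *)
Lemma upper_tail_ratio n i : (i <= n)%N ->
  i%:R * \sum_(i.+1 <= k < n.+1) w k <=
  p * (r + i%:R) * \sum_(i <= k < n.+1) w k.
Proof.
move=> /subnKC; move: (n - i)%N => d <-; elim: d i => [|d IH] i.
  rewrite addn0 big_geq// mulr0 mulr_ge0 ?sum_weight_ge0//.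
  exact/ltW/rate_gt0.
have lt1 : (i < (i + d.+1).+1)%N by rewrite ltnS leq_addr.
have lt2 : (i.+1 < (i + d.+1).+1)%N by rewrite ltnS -addSnnS leq_addr.
have := w_rec i; have := w_gt0 i.+1; have := sum_weight_ge0 i.+2 (i + d.+1).+1.
move: (IH i.+1); rewrite addSnnS (big_ltn lt1) (big_ltn lt2) -!natr1.
set V := \sum_(i.+2 <= k < _) w k => {}IH V0 wi rec.
have : 0 <= (1 - p) * (w i.+1 + V).
  by rewrite mulr_ge0 ?subr_ge0 ?addr_ge0// ltW.
lra.
Qed.

(** The left-hand side is the increment at i of the Stein solution for the
    indicator of {i}. Both terms are compared with complementary parts of the
    right-hand sum: the mass above i and the mass of {1, ..., i}. *)
Lemma diagonal_coef_le n i : (0 < i <= n)%N ->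
  (\sum_(i.+1 <= k < n.+1) w k) / (p * (r + i%:R))
    + (\sum_(0 <= k < i) w k) / i%:R
  <= (\sum_(1 <= k < n.+1) w k) / (p * r).
Proof.
move=> /andP[i0 iin].
have pr0 : 0 < p * r by rewrite mulr_gt0.
rewrite (@big_cat_nat _ _ _ i.+1 1 n.+1)//= mulrDl addrC lerD//.
  rewrite ler_pdivrMr ?ltr0n// mulrAC ler_pdivlMr//.
  (* Termwise: p r w(k) <= p (r+k) w(k) = (k+1) w(k+1) <= i w(k+1) for k < i. *)
  rewrite big_add1/= mulr_suml [leRHS]mulr_suml.
  apply: ler_sum_nat => k /andP[_ ki].
  apply: (@le_trans _ _ (p * (r + k%:R) * w k)).
    by rewrite mulrC ler_wpM2r ?(ltW (w_gt0 k))// ler_pM2l// lerDl.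
  by rewrite -w_rec mulrC ler_wpM2l ?ler_nat// ltW.
rewrite ler_wpM2l ?sum_weight_ge0// lef_pV2 ?posrE ?rate_gt0//.
by rewrite ler_pM2l// lerDl.
Qed.

End Weights.

(** * The solution of the Stein equation and its increments *)

Section SteinSolution.
Context (R : realType) (r p : R) (w : nat -> R) (n : nat) (mu : probability nat R).
Hypotheses (r_gt0 : 0 < r) (p_gt0 : 0 < p) (p_lt1 : p < 1).
Hypothesis w_gt0 : forall k, 0 < w k.
Hypothesis w_rec : forall k, k.+1%:R * w k.+1 = p * (r + k%:R) * w k.
Hypothesis w_sum1 : \sum_(0 <= k < n.+1) w k = 1.
Context (f : nat -> R).
Hypothesis mean_f : fine 'E_mu[f] = \sum_(0 <= k < n.+1) w k * f k.

Let csum i := \sum_(0 <= k < i) w k * (f k - fine 'E_mu[f]).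

Let csumE i : csum i = \sum_(0 <= k < i) w k * f k
                 - (\sum_(0 <= k < i) w k) * fine 'E_mu[f].
Proof. by rewrite mulr_suml -sumrB; apply: eq_bigr => k _; rewrite mulrBr. Qed.

Let csum_last : csum n.+1 = 0.
Proof. by rewrite csumE w_sum1 mul1r mean_f subrr. Qed.

Let csumS i : csum i.+1 = csum i + w i * (f i - fine 'E_mu[f]).
Proof. by rewrite /csum big_nat_recr. Qed.

Lemma exists_stein_solution : exists g, is_stein_solution r p mu n f g.
Proof.
exists (fun i => if (0 < i <= n)%N then csum i / (i%:R * w i) else 0).
split; rewrite ?ltnn// => i le_in; have [->|lt_in] : i = n \/ (i < n)%N.
- by apply/predU1P; rewrite -leq_eqVlt.
-  rewrite /= ltnn mulr0 sub0r leqnn andbT.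
  have /eqP := csum_last; rewrite csumS; case: posnP => [->|n0].
    rewrite mul0r oppr0 /csum big_geq// add0r mulf_eq0 gt_eqF//=.
    by move=> /eqP ->.
  rewrite addrC addr_eq0 => /eqP Hn.
  apply: (mulfI (lt0r_neq0 (w_gt0 n))); rewrite Hn.
  by field; rewrite gt_eqF ?w_gt0// gt_eqF// ltr0n.
- rewrite lt_in mulr1 /= w_rec csumS le_in andbT.
have wi := lt0r_neq0 (w_gt0 i).
have rate : p * (r + i%:R) != 0 by rewrite gt_eqF// rate_gt0.
have -> : i%:R * (if (0 < i)%N then csum i / (i%:R * w i) else 0) = csum i / w i.
  case: posnP => [->|i0]; first by rewrite mul0r /csum big_geq// mul0r.
  by field; rewrite wi gt_eqF// ltr0n.
by move: rate; set Q := p * _ => rate; field; rewrite wi rate.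
Qed.

Context (g : nat -> R).
Hypothesis g_sol : is_stein_solution r p mu n f g.

(* The Stein equation multiplied by w(i) telescopes. *)
Let g_left i : (i <= n)%N -> i%:R * w i * g i = csum i.
Proof.
have [g0 _ geq] := g_sol.
elim: i => [|i IH lt_in]; first by rewrite !mul0r /csum big_geq.
have le_in := ltnW lt_in.
by rewrite w_rec csumS -(IH le_in) -(geq _ le_in) lt_in mulr1; ring.
Qed.

(* At i = n both sides vanish: the left by the convention g(n+1) = 0, the right
   because f - E f has mean zero. The increment formulas below therefore need no
   special case at the right end. *)
Let g_right i : (i <= n)%N -> p * (r + i%:R) * w i * g i.+1 = csum i.+1.
Proof.
rewrite leq_eqVlt => /predU1P[->|lt_in]; last by rewrite -w_rec g_left.
by have [_ -> _] := g_sol; rewrite mulr0 csum_last.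
Qed.

Let below i := \sum_(0 <= k < i) w k * f k.
Let above i := \sum_(i.+1 <= k < n.+1) w k * f k.
Let F i := \sum_(0 <= k < i) w k.
Let U i := \sum_(i.+1 <= k < n.+1) w k.

Let split_at (u : nat -> R) i : (i <= n)%N ->
  \sum_(0 <= k < n.+1) u k =
  \sum_(0 <= k < i) u k + u i + \sum_(i.+1 <= k < n.+1) u k.
Proof. by move=> le_in; rewrite (@big_cat_nat _ _ _ i.+1)//= big_nat_recr. Qed.

Let total_at i : (i <= n)%N -> F i + w i + U i = 1.
Proof. by move=> le_in; rewrite -w_sum1 (split_at _ le_in). Qed.

Let mean_at i : (i <= n)%N -> fine 'E_mu[f] = below i + w i * f i + above i.
Proof. by move=> le_in; rewrite mean_f (split_at _ le_in). Qed.

Let below0 : below 0 = 0. Proof. by rewrite /below big_geq. Qed.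

Let F0 : F 0 = 0. Proof. by rewrite /F big_geq. Qed.

(** At i = 0 the equation says nothing about g(0), so this increment comes from
    the convention g(0) = 0; it is the one that attains the bound. *)
Lemma stein_increment0 :
  g 1%N - g 0%N = (U 0%N * f 0%N - above 0%N) / (p * r).
Proof.
have [g0 _ _] := g_sol; have := g_right (leq0n n).
have := total_at (leq0n n); rewrite F0 add0r addr0 => U0.
rewrite csumS /csum big_geq// add0r (mean_at (leq0n n)) below0 add0r => hg.
have w0 := lt0r_neq0 (w_gt0 0).
have pr : p * r != 0 by rewrite gt_eqF// mulr_gt0.
apply: (mulfI w0); apply: (mulfI pr); rewrite g0 subr0 mulrA hg.
have -> : U 0 = 1 - w 0%N by rewrite -U0; ring.
by move: pr; set Q := p * r => pr; field.
Qed.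

(** The increment as a linear form in the values of f: only the coefficient of
    f(i) is positive, the other two parenthesised coefficients being nonnegative
    by the tail inequalities. *)
Lemma stein_increment i : (0 < i <= n)%N ->
  w i * (g i.+1 - g i) =
    w i * f i * (U i / (p * (r + i%:R)) + F i / i%:R)
    - below i * ((U i + w i) / i%:R - U i / (p * (r + i%:R)))
    - above i * ((F i + w i) / (p * (r + i%:R)) - F i / i%:R).
Proof.
move=> /andP[i0 le_in].
have i_neq0 : i%:R != 0 :> R by rewrite gt_eqF// ltr0n.
have : p * (r + i%:R) != 0 by rewrite gt_eqF// rate_gt0.
have := g_right le_in; have := g_left le_in; rewrite csumS csumE (mean_at le_in).
rewrite -/(F i) -/(below i).
have -> : U i = 1 - F i - w i by rewrite -(total_at le_in); ring.
set Q := p * (r + i%:R) => hl hr Q_neq0.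
have -> : w i * (g i.+1 - g i) = Q * w i * g i.+1 / Q - i%:R * w i * g i / i%:R.
  by field; rewrite ?Q_neq0 ?i_neq0.
by rewrite hl hr; field; rewrite ?Q_neq0 ?i_neq0.
Qed.

Hypothesis f01 : forall k, 0 <= f k <= 1.

Let wf_bounds k : 0 <= w k * f k <= w k.
Proof.
have /andP[fk0 fk1] := f01 k; rewrite mulr_ge0 ?(ltW (w_gt0 k))//=.
by rewrite ler_piMr// ltW.
Qed.

Let sum_wf_bounds i j :
  0 <= \sum_(i <= k < j) w k * f k <= \sum_(i <= k < j) w k.
Proof.
apply/andP; split; first by apply: sumr_ge0 => k _; have /andP[] := wf_bounds k.
by apply: ler_sum => k _; have /andP[] := wf_bounds k.
Qed.

(** Since f(i) enters positively and all other values negatively, the extreme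
    increments over 0 <= f <= 1 come from the indicator of {i} and from its
    complement, and they are opposite because f = 1 has increment 0. *)
Lemma stein_increment_le i : (i <= n)%N ->
  `|g i.+1 - g i| <= (\sum_(1 <= k < n.+1) w k) / (p * r).
Proof.
have [->|i0] := posnP i => le_in.
  rewrite stein_increment0 normrM [X in _ * X]ger0_norm; last first.
    by rewrite invr_ge0 mulr_ge0 ?ltW.
  rewrite ler_wpM2r ?invr_ge0 ?mulr_ge0 ?(ltW p_gt0) ?(ltW r_gt0)// -/(U 0).
  have /andP[B0 BU] := sum_wf_bounds 1 n.+1; have /andP[f0 f1] := f01 0.
  rewrite -/(above 0) -/(U 0) in B0 BU; rewrite ler_norml; nra.
have i_in : (0 < i <= n)%N by rewrite i0.
apply: le_trans (diagonal_coef_le r_gt0 p_gt0 w_gt0 w_rec i_in).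
rewrite -(ler_pM2l (w_gt0 i)) -[X in X * `|_|](gtr0_norm (w_gt0 i)) -normrM.
rewrite stein_increment//.
have Q_gt0 := rate_gt0 r_gt0 p_gt0 i; have iR : 0 < i%:R :> R by rewrite ltr0n.
have a_ge0 : 0 <= (U i + w i) / i%:R - U i / (p * (r + i%:R)).
  rewrite subr_ge0 ler_pdivrMr// mulrAC ler_pdivlMr// mulrC.
  have := upper_tail_ratio r_gt0 p_gt0 p_lt1 w_gt0 w_rec le_in.
  rewrite (@big_ltn _ _ _ i) ?ltnS// -/(U i) [w i + _]addrC.
  by rewrite [leRHS]mulrC.
have b_ge0 : 0 <= (F i + w i) / (p * (r + i%:R)) - F i / i%:R.
  rewrite subr_ge0 ler_pdivrMr// mulrAC ler_pdivlMr// mulrC.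
  have := lower_tail_ratio p_lt1 w_gt0 w_rec i.
  by rewrite big_nat_recr//= -/(F i) [leRHS]mulrC.
have /andP[A0 AF] := sum_wf_bounds 0 i.
have /andP[B0 BU] := sum_wf_bounds i.+1 n.+1.
have /andP[fi0 fi1] := wf_bounds i.
rewrite -/(below i) -/(F i) in A0 AF; rewrite -/(above i) -/(U i) in B0 BU.
rewrite -/(F i) -/(U i).
set a := _ / i%:R - _ in a_ge0 *; set b := _ - F i / i%:R in b_ge0 *.
set c := _ / _ + _.
have c_ge0 : 0 <= c.
  by rewrite addr_ge0// divr_ge0 ?(ltW Q_gt0) ?sum_weight_ge0// ltW.
(* This is the vanishing of the increment for f = 1; it turns the lower bound
   - a F(i) - b U(i) into - c w(i). *)
have cE : w i * c = F i * a + U i * b.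
  rewrite /a /b /c; set Q := p * (r + i%:R).
  by field; rewrite !gt_eqF.
have hc1 := ler_wpM2r c_ge0 fi1.
have hc0 := mulr_ge0 fi0 c_ge0.
have ha1 := ler_wpM2r a_ge0 AF.
have ha0 := mulr_ge0 A0 a_ge0.
have hb1 := ler_wpM2r b_ge0 BU.
have hb0 := mulr_ge0 B0 b_ge0.
rewrite ler_norml; apply/andP; split; lra.
Qed.

End SteinSolution.

(** * The negative binomial law and its truncation *)

Lemma measure_nat_leq (R : realType) (mu : {measure set nat -> \bar R})
    (w : nat -> R) (mu_pt : forall k, mu [set k] = (w k)%:E) (n : nat)
    (A : set nat) :
  mu (A `&` [set k | (k <= n)%N]) = (\sum_(0 <= k < n.+1) w k * \1_A k)%:E.
Proof.
have mu_piece k : mu (A `&` [set k]) = (w k * \1_A k)%:E.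
  have [Ak|nAk] := pselect (A k).
    rewrite indicE mem_set// mulr1 -mu_pt; congr (mu _).
    by apply/seteqP; split => [j []//|j ->].
  rewrite indicE memNset// mulr0 (_ : A `&` _ = set0) ?measure0//.
  by apply/seteqP; split => // j [Aj jk]; apply: nAk; rewrite -jk.
elim: n => [|n IH].
  rewrite big_nat1 -mu_piece; congr (mu (A `&` _)).
  by apply/seteqP; split => k /=; rewrite leqn0 => /eqP.
rewrite big_nat_recr//= EFinD -IH -mu_piece -measureU//.
  rewrite -setIUr; congr (mu (A `&` _)).
  apply/seteqP; split => k /=.
    by rewrite leq_eqVlt => /predU1P[->|]; [right|left].
  by move=> [/leqW|->].
by apply/seteqP; split => // k [[_ /= kn] [_ /= kE]]; rewrite kE ltnn in kn.
Qed.

(** The detailed-balance relation between the birth rates p (r + k) and the death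
    rates k, which identifies the law as the one of the Stein equation. *)
Lemma nb_pmf_rec (R : realType) (r p : R) (k : nat) : 0 < r ->
  k.+1%:R * nb_pmf r p k.+1 = p * (r + k%:R) * nb_pmf r p k.
Proof.
move=> r0; rewrite /nb_pmf -natr1 addrA Gamma_add1 ?ltr_pwDl//.
rewrite factS natrM !invfM exprS -natr1.
have k1 : k%:R + 1 != 0 :> R by rewrite natr1 pnatr_eq0.
have k_fact : k`!%:R != 0 :> R by rewrite pnatr_eq0 -lt0n fact_gt0.
by set c := (Gamma r)^-1; field; rewrite k_fact.
Qed.

Section NegativeBinomial.
Context (R : realType) (r p : R) (d : measure_display) (T : measurableType d)
  (P : probability T R) (Z : {RV P >-> nat}).
Hypotheses (r_gt0 : 0 < r) (p_gt0 : 0 < p) (p_lt1 : p < 1).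
Hypothesis Z_nb : is_NB r p Z.

Let w := nb_pmf r p.
Let W n := \sum_(0 <= k < n.+1) w k.

Let law_pt k : distribution P Z [set k] = (w k)%:E.
Proof. exact: Z_nb. Qed.

(** If the mass at 0 vanished, so would every mass by the recursion, against total
    mass 1; so Gamma r <> 0 follows from the existence of Z. *)
Lemma nb_pmf_gt0 k : 0 < nb_pmf r p k.
Proof.
have w_ge0 j : 0 <= w j by rewrite -lee_fin -law_pt measure_ge0.
elim: k => [|k IH]; last first.
  rewrite -(pmulr_rgt0 _ (ltr0Sn R k)) nb_pmf_rec// mulr_gt0//.
  by rewrite mulr_gt0// ltr_pwDl.
rewrite lt_neqAle w_ge0 andbT; apply/negP => /eqP w0.
have w_eq0 j : w j = 0.
  elim: j => [//|j IH]; apply: (mulfI (lt0r_neq0 (ltr0Sn R j))).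
  by rewrite /w nb_pmf_rec// -/w IH !mulr0.
have : (distribution P Z setT <= 0)%E.
  have -> : (0 = \sum_(0 <= k <oo) distribution P Z [set k])%E.
    by rewrite eseries0// => k _ _; rewrite law_pt w_eq0.
  by apply: measure_sigma_subadditive => // k _; exists k.
by rewrite probability_setT lee_fin ler10.
Qed.

Let W_gt0 n : 0 < W n.
Proof.
rewrite /W big_nat_recr//= ltr_wpDl ?nb_pmf_gt0// sumr_ge0// => k _.
exact/ltW/nb_pmf_gt0.
Qed.

Lemma prob_nb_leq n (A : set nat) :
  P [set t | A (Z t) /\ (Z t <= n)%N] = (\sum_(0 <= k < n.+1) w k * \1_A k)%:E.
Proof. exact: measure_nat_leq law_pt n A. Qed.

Lemma truncated_lawE n (A : set nat) :
  truncated_law Z n A = (\sum_(0 <= k < n.+1) w k / W n * \1_A k)%:E.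
Proof.
have total : mrestr (distribution P Z) (measurable_leqn n) setT = (W n)%:E.
  rewrite /mrestr (measure_nat_leq law_pt); congr EFin.
  by apply: eq_bigr => k _; rewrite indicT mulr1.
rewrite /truncated_law /= /mnormalize [X in (X == 0%E) || _]total.
rewrite [X in _ || (X == _)]total [X in fine X]total eqe gt_eqF//=.
rewrite /mrestr (measure_nat_leq law_pt) -EFinM mulr_suml; congr EFin.
by apply: eq_bigr => k _; rewrite mulrAC.
Qed.

Lemma truncated_law_mean n (A : set nat) :
  fine 'E_(truncated_law Z n)[\1_A] = \sum_(0 <= k < n.+1) w k / W n * \1_A k.
Proof. by rewrite expectation_indic// truncated_lawE. Qed.

Let wn n k := w k / W n.

Let wn_gt0 n k : 0 < wn n k.
Proof. by apply: divr_gt0; [exact: nb_pmf_gt0|exact: W_gt0]. Qed.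

Let wn_rec n k : k.+1%:R * wn n k.+1 = p * (r + k%:R) * wn n k.
Proof. by rewrite /wn mulrA /w nb_pmf_rec// [RHS]mulrA. Qed.

Let wn_sum1 n : \sum_(0 <= k < n.+1) wn n k = 1.
Proof. by rewrite -mulr_suml divff// gt_eqF// W_gt0. Qed.

(** * The bound, its sharpness and its monotonicity *)

Lemma pi0E n : pi0 Z n = w 0 / W n.
Proof.
rewrite /pi0 truncated_lawE/= big_ltn// indicE mem_set// mulr1.
rewrite big_nat big1 ?addr0// => k /andP[k0 _].
by rewrite indicE memNset ?mulr0// => kE; rewrite kE in k0.
Qed.

Lemma G2_boundE n :
  G2_bound r p Z n = (\sum_(1 <= k < n.+1) w k / W n) / (p * r).
Proof.
by rewrite /G2_bound pi0E -[X in X - _](wn_sum1 n) big_ltn// addrAC subrr add0r.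
Qed.

Lemma G2_le_bound n :
  (G2 r p (truncated_law Z n) n <= (G2_bound r p Z n)%:E)%E.
Proof.
apply: ge_ereal_sup => _ [g [A _ g_sol] <-].
apply: ge_ereal_sup => _ [i i_le <-].
rewrite lee_fin G2_boundE.
apply: (stein_increment_le r_gt0 p_gt0 p_lt1 (wn_gt0 n) (wn_rec n) (wn_sum1 n)
  (truncated_law_mean n A) g_sol _ i_le) => k.
by rewrite indicE; case: (_ \in _); rewrite ?lexx ?ler01.
Qed.

(** The supremum is reached by the indicator of {0} at i = 0, where the mass that f
    puts above 0 is zero; for n = 0 both sides are 0. *)
Lemma G2_ge_bound n :
  ((G2_bound r p Z n)%:E <= G2 r p (truncated_law Z n) n)%E.
Proof.
have [g g_sol] := exists_stein_solution r_gt0 p_gt0 (wn_gt0 n) (wn_rec n)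
  (wn_sum1 n) (truncated_law_mean n [set 0%N]).
apply: le_ereal_sup_tmp; exists (ereal_sup
    [set `|g i.+1 - g i|%:E | i in [set i | (i <= n)%N]]).
  by exists g => //; exists [set 0%N] => // _ ->.
apply: le_ereal_sup_tmp; exists `|g 1%N - g 0%N|%:E; first by exists 0%N.
rewrite lee_fin G2_boundE.
have -> : g 1%N - g 0%N = (\sum_(1 <= k < n.+1) wn n k) / (p * r).
  rewrite (stein_increment0 r_gt0 p_gt0 (wn_gt0 n) (wn_rec n) (wn_sum1 n)
    (truncated_law_mean n [set 0%N]) g_sol).
  rewrite [X in _ * _ - X]big_nat [X in _ * _ - X]big1 => [|k /andP[k0 _]].
    by rewrite indicE mem_set// mulr1 subr0.
  by rewrite indicE memNset ?mulr0// => kE; rewrite kE in k0.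
exact: ler_norm.
Qed.

Lemma G2_bound_lt m n : (m < n)%N -> G2_bound r p Z m < G2_bound r p Z n.
Proof.
move=> mn; rewrite /G2_bound !pi0E ltr_pM2r ?invr_gt0 ?mulr_gt0//.
rewrite ltrD2l ltrN2 ltr_pM2l ?nb_pmf_gt0// ltf_pV2 ?posrE//.
rewrite /W (@big_cat_nat _ _ _ m.+1 0 n.+1)//= ?ltnS 1?ltnW//.
rewrite ltrDl big_ltn// ltr_pwDl ?nb_pmf_gt0// sumr_ge0// => k _.
exact/ltW/nb_pmf_gt0.
Qed.

Lemma prob_nb_le n : P [set t | (Z t <= n)%N] = (W n)%:E.
Proof.
have := prob_nb_leq n setT; rewrite indicT.
under eq_bigr do rewrite mulr1.
by move=> <-; congr (P _); apply/seteqP; split => t //= [].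
Qed.

Lemma prob_nb_itv n :
  P [set t | (1 <= Z t <= n)%N] = (\sum_(1 <= k < n.+1) w k)%:E.
Proof.
have -> : [set t | (1 <= Z t <= n)%N] =
    [set t | [set k | (0 < k)%N] (Z t) /\ (Z t <= n)%N].
  by apply/seteqP; split => t /= /andP.
rewrite prob_nb_leq big_ltn// indicE memNset// mulr0 add0r; congr EFin.
by apply: eq_big_nat => k /andP[k0 _]; rewrite indicE mem_set// mulr1.
Qed.

End NegativeBinomial.

Theorem lemma2p2 (R : realType) (r p : R) (hr : 0 < r) (hp0 : 0 < p) (hp1 : p < 1)
    (d : measure_display) (T : measurableType d) (P : probability T R)
    (Z : {RV P >-> nat}) (hZ : is_NB r p Z) :
  (forall n : nat,
    [/\ (G2 r p (truncated_law Z n) n <= (G2_bound r p Z n)%:E)%E,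
        pi0 Z n = fine (P [set t | Z t = 0%N]) / fine (P [set t | (Z t <= n)%N]),
        G2_bound r p Z n =
          fine (P [set t | (1 <= Z t <= n)%N])
          / (p * r * fine (P [set t | (Z t <= n)%N]))
      & (* sharpness *)
        G2 r p (truncated_law Z n) n = (G2_bound r p Z n)%:E])
  /\ (forall m n : nat, (m < n)%N -> G2_bound r p Z m < G2_bound r p Z n).
Proof.
split=> [n|m n mn]; last exact: G2_bound_lt.
split; first exact: G2_le_bound.
- by rewrite (pi0E hr hp0 hZ) (prob_nb_le hZ) hZ.
- rewrite (G2_boundE hr hp0 hZ) (prob_nb_le hZ) (prob_nb_itv hZ)/=.
  by rewrite -mulr_suml -mulrA -invfM; congr (_ / _); exact: mulrC.
- apply/eqP; rewrite eq_le (G2_le_bound hr hp0 hp1 hZ).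
  by rewrite (G2_ge_bound hr hp0 hZ).
Qed.
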